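(* Let $\Lambda=\{\Lambda_\omega\in B(\mathcal{H},\mathcal{K}_\omega):\omega\in\Omega\}$ be a continuous $g$-frame with lower and upper bounds $A_\Lambda,B_\Lambda$, and let $\Theta=\{\Theta_\omega\in B(\mathcal{H},\mathcal{K}_\omega):\omega\in\Omega\}$ be a family of operators such that for each $f\in\mathcal{H}$, $\{\Theta_\omega f\}_{\omega\in\Omega}$ is strongly measurable. Suppose there exists $\nu\in[0,\frac{A_\Lambda^2}{B_\Lambda})$ such that $$\int_\Omega\|(\Lambda_\omega-\Theta_\omega)f\|^2\,d\mu(\omega)\le\nu\|f\|^2,\quad f\in\mathcal{H}.$$ Let $m\in L^\infty(\Omega,\mu)$ be such that $\|m-1\|_\infty\le\lambda<\frac{A_\Lambda-\sqrt{\nu B_\Lambda}}{B_\Lambda+\sqrt{\nu B_\Lambda}}$ for some $\lambda$. Then $M_{m,\Lambda,\Theta}\in GL(\mathcal{H})$ and $$\frac{1}{(\lambda+1)(B_\Lambda+\sqrt{\nu B_\Lambda})}\|f\|\le\|M_{m,\Lambda,\Theta}^{-1}f\|\le\frac{1}{A_\Lambda-\lambda B_\Lambda-(\lambda+1)\sqrt{\nu B_\Lambda}}\|f\|,\quad f\in\mathcal{H},$$ and $$M_{m,\Lambda,\Theta}^{-1}=\sum_{k=0}^\infty\big[M_{m,\Lambda,\Lambda}^{-1}(M_{m,\Lambda,\Lambda}-M_{m,\Lambda,\Theta})\big]^kM_{m,\Lambda,\Lambda}^{-1},$$ where, for all $n\in\mathbb{N}$, $$\Big\|M_{m,\Lambda,\Theta}^{-1}-\sum_{k=0}^n\big[M_{m,\Lambda,\Lambda}^{-1}(M_{m,\Lambda,\Lambda}-M_{m,\Lambda,\Theta})\big]^kM_{m,\Lambda,\Lambda}^{-1}\Big\|\le\Big(\frac{(\lambda+1)\sqrt{\nu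 B_\Lambda}}{A_\Lambda-\lambda B_\Lambda}\Big)^{n+1}\frac{1}{A_\Lambda-\lambda B_\Lambda-(\lambda+1)\sqrt{\nu B_\Lambda}}.$$
   Context: $(\Omega,\mu)$ is a measure space with positive measure $\mu$, $\mathcal{H}$ is a Hilbert space, $\{\mathcal{K}_\omega:\omega\in\Omega\}$ is a family of Hilbert spaces, $B(\mathcal{H},\mathcal{K}_\omega)$ is the space of bounded linear operators, and $GL(\mathcal{H})$ is the set of all invertible bounded linear operators on $\mathcal{H}$. An element $F\in\prod_{\omega\in\Omega}\mathcal{K}_\omega$ is strongly measurable if $F$, as a mapping of $\Omega$ to $\bigoplus_{\omega\in\Omega}\mathcal{K}_\omega$, is measurable. A family $\Lambda=\{\Lambda_\omega\in B(\mathcal{H},\mathcal{K}_\omega):\omega\in\Omega\}$ is a continuous $g$-frame for $\mathcal{H}$ with respect to $\{\mathcal{K}_\omega\}$ if (a) for each $f\in\mathcal{H}$, $\{\Lambda_\omega f:\omega\in\Omega\}$ is strongly measurable, and (b) there are constants $0<A_\Lambda\le B_\Lambda<\infty$ (lower and upper continuous $g$-frame bounds) with $A_\Lambda\|f\|^2\le\int_\Omega\|\Lambda_\omega f\|^2\,d\mu(\omega)\le B_\Lambda\|f\|^2$ for all $f\in\mathcal{H}$. It is a continuous $g$-Bessel family if (a) holds and the right-hand inequality in (b) holds for all $f\in\mathcal{H}$. $M_{m,\Lambda,\Theta}:\mathcal{H}\to\mathcal{H}$ denotes the operator defined by $\langle M_{m,\Lambda,\Theta}f,g\rangle=\int_\Omega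 m(\omega)\langle\Theta_\omega f,\Lambda_\omega g\rangle\,d\mu(\omega)$ for $f,g\in\mathcal{H}$, whenever this formula defines a bounded operator (in particular whenever $\Lambda,\Theta$ are continuous $g$-Bessel families and $m\in L^\infty(\Omega,\mu)$); $M_{m,\Lambda,\Lambda}$ is the case $\Theta=\Lambda$. *)

(* Defs.v *)
From HB Require Import structures.
From mathcomp Require Import all_boot all_order all_algebra.
From mathcomp Require Import sesquilinear.
From mathcomp Require Import complex.
From mathcomp Require Import all_classical all_reals all_analysis.

Set Implicit Arguments.
Unset Strict Implicit.
Unset Printing Implicit Defensive.

Import Order.TTheory GRing.Theory Num.Theory.
Import numFieldNormedType.Exports.

Local Open Scope classical_set_scope.
Local Open Scope ring_scope.
Local Open Scope complex_scope.

(* Complex Hilbert spaces, over the scalar field [R[i]].  The inner product is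
   linear in its first argument and conjugate-linear in the second. *)
HB.mixin Record NormedModule_isHilbert (R : realType) H
    & CompleteNormedModule R[i] H := {
  hdot : {dot H for @Num.conj R[i]} ;
  normr_hdot : forall x : H, `|x| ^+ 2 = hdot x x
}.

#[short(type="hilbertType")]
HB.structure Definition Hilbert (R : realType) :=
  {H of CompleteNormedModule R[i] H & NormedModule_isHilbert R H}.

(* The norm of a normed module over [R[i]] takes its values in [R[i]]. *)
Definition rnorm (R : realType) (V : normedModType R[i]) (x : V) : R :=
  complex.Re `|x|.

Section BoundedOperators.
Context {R : realType}.
Implicit Types H K : normedModType R[i].

Definition bounded_operator H K (T : H -> K) : Prop :=
  linear T /\ exists c : R, forall f : H, rnorm (T f) <= c * rnorm f.

Definition opnorm H K (T : H -> K) : \bar R :=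
  ereal_sup [set (rnorm (T f))%:E | f in [set f : H | rnorm f <= 1]].

Definition GL H : set (H -> H) :=
  [set T | bounded_operator T /\
    exists S : H -> H, [/\ bounded_operator S, cancel T S & cancel S T]].

(* The two-sided inverse of [T]; junk if there is none. *)
Definition opinv H (T : H -> H) : H -> H := 'pinv_(fun=> 0) [set: H] T.

End BoundedOperators.

Section StrongMeasurability.
Context {R : realType} {d : measure_display} {Omega : measurableType d}.
Variable K : Omega -> hilbertType R.

(* The square of the l^2 norm on the product of the [K w]. *)
Definition l2norm2 (x : forall w, K w) : \bar R :=
  (\esum_(w in [set: Omega]) (rnorm (x w) ^+ 2)%:E)%E.

(* The Hilbert direct sum of the [K w]. *)
Definition hsum : set (forall w, K w) := [set x | (l2norm2 x < +oo)%E].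

Definition hsum_open : set (set (forall w, K w)) :=
  [set U | U `<=` hsum /\ forall x, U x -> exists2 e : R, 0 < e &
    forall y, hsum y -> (l2norm2 (fun w => y w - x w)%R < (e ^+ 2)%:E)%E -> U y].

Definition hsum_inj (w : Omega) (v : K w) : forall w', K w' :=
  eqtype.dfwith (fun w' => 0 : K w') v.

(* [F] is strongly measurable when [w |-> F w], seen as a map from [Omega] to
   the Hilbert direct sum through the inclusions of the summands, is measurable
   for the Borel sigma-algebra of the direct sum. *)
Definition strongly_measurable (F : forall w, K w) : Prop :=
  forall B, <<s hsum, hsum_open >> B ->
    measurable [set w | B (hsum_inj (F w))].

End StrongMeasurability.

Section ComplexFunctions.
Context {R : realType} {d : measure_display} {Omega : measurableType d}.
Variable mu : {measure set Omega -> \bar R}.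
Implicit Types F : Omega -> R[i].

Definition cmeasurable F : Prop :=
  measurable_fun [set: Omega] (fun w => complex.Re (F w)) /\
  measurable_fun [set: Omega] (fun w => complex.Im (F w)).

Definition cintegrable F : Prop :=
  mu.-integrable [set: Omega] (fun w => (complex.Re (F w))%:E) /\
  mu.-integrable [set: Omega] (fun w => (complex.Im (F w))%:E).

Definition cintegral F : R[i] :=
  (\int[mu]_w complex.Re (F w)) +i* (\int[mu]_w complex.Im (F w)).

Definition cesssup F : \bar R :=
  Lnorm mu +oo%E (fun w => (complex.Re `|F w|)%:E).

Definition cLinfty : set (Omega -> R[i]) :=
  [set F | cmeasurable F /\ (cesssup F < +oo)%E].

End ComplexFunctions.

Section ContinuousGFrames.
Context {R : realType} {d : measure_display} {Omega : measurableType d}.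
Variable mu : {measure set Omega -> \bar R}.
Context {H : hilbertType R} {K : Omega -> hilbertType R}.
Implicit Types Lambda Theta : forall w, H -> K w.

Definition cgframe Lambda (A B : R) : Prop :=
  [/\ forall f, strongly_measurable (fun w => Lambda w f),
      0 < A <= B &
      forall f, ((A * rnorm f ^+ 2)%:E <=
                 \int[mu]_w (rnorm (Lambda w f) ^+ 2)%:E <=
                 (B * rnorm f ^+ 2)%:E)%E].

Definition multiplier_integrand (m : Omega -> R[i]) Lambda Theta (f g : H) :
    Omega -> R[i] :=
  fun w => m w * hdot (Theta w f) (Lambda w g).

Definition is_multiplier (m : Omega -> R[i]) Lambda Theta (M : H -> H) : Prop :=
  bounded_operator M /\
  forall f g : H, cintegrable mu (multiplier_integrand m Lambda Theta f g) /\
    hdot (M f) g = cintegral mu (multiplier_integrand m Lambda Theta f g).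

(* The operator M_{m,Lambda,Theta}: the unique bounded operator given by the weak
   formula, or 0 if that formula does not define a bounded operator. *)
Definition multiplier (m : Omega -> R[i]) Lambda Theta : H -> H :=
  xget (fun=> 0) [set M | is_multiplier m Lambda Theta M].

End ContinuousGFrames.

(* Main.v *)
Require Import Defs.
From mathcomp Require Import all_boot all_order all_algebra.
From mathcomp Require Import complex.
From mathcomp Require Import all_classical all_reals all_analysis.
From mathcomp Require Import sesquilinear measurable_realfun ess_sup_inf.
From mathcomp Require Import ring lra.

Import Order.TTheory GRing.Theory Num.Theory.
Import numFieldNormedType.Exports.

Local Open Scope classical_set_scope.
Local Open Scope ring_scope.

(**
  Write [s] for [sqrt (nu * B)], [M] and [M0] for the multipliers of
  [(Lambda, Theta)] and [(Lambda, Lambda)], and [Psi] for [Lambda - Theta].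

  Everything rests on one estimate, a weighted Cauchy-Schwarz inequality: if
  [|m| <= c] almost everywhere, [\int |F|^2 <= a^2] and [\int |G|^2 <= b^2],
  then the real part of [m <F, G>] is integrable, with integral at most [c a b]
  ([mform_integral_le]).  Since [|m| <= lambda + 1], it bounds the form
  of [M0] by [(lambda + 1) B] and the form of [Psi] by [(lambda + 1) s].  The
  form of [M] is the difference of these two, so it is bounded by
  [(lambda + 1) (B + s)]; a bounded form is represented by a bounded operator
  ([riesz], [multiplier_spec]), so [M] and [M0] exist,
  [|M f| <= (lambda + 1) (B + s) |f|] and [|M0 f - M f| <= (lambda + 1) s |f|].

  The lower bounds come from coercivity.  Writing [m = 1 - (1 - m)] with
  [|1 - m| <= lambda], the frame inequality and the same estimate give
  [Re <M0 f, f> >= (A - lambda B) |f|^2], and perturbing by [M0 - M] gives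
  [Re <M f, f> >= (A - lambda B - (lambda + 1) s) |f|^2].  The bound on [lambda]
  says exactly that this last constant is positive.  A coercive bounded operator
  is invertible, with inverse bounded by the reciprocal of the constant
  ([coercive_surj], [rnorm_opinv_le]).

  For the series, put [T := M0^-1 (M0 - M)].  From [x = M0^-1 M x + T x] one gets
  [M^-1 - \sum_(k < n) T^k M0^-1 = T^n M^-1] ([neumann_remainder]), and
  [|T| <= (lambda + 1) s / (A - lambda B) < 1].

  Integrals of complex functions are avoided by working with the real inner
  product [Re <x, y>], which determines [<x, y>] because
  [Im <x, y> = Re <x, i y>].
*)

(** * The real inner product of a complex Hilbert space *)

Section RealInnerProduct.
Set Implicit Arguments.
Unset Strict Implicit.
Unset Printing Implicit Defensive.
Local Open Scope complex_scope.
Context {R : realType} {H : hilbertType R}.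
Implicit Types (x y z : H) (a b : R[i]) (t : R).

Lemma complexReD a b : complex.Re (a + b) = complex.Re a + complex.Re b.
Proof. by case: a b => [? ?] []. Qed.

Lemma complexReN a : complex.Re (- a) = - complex.Re a.
Proof. by case: a. Qed.

Lemma complexReZ t a : complex.Re (t%:C * a) = t * complex.Re a.
Proof. by case: a => u v /=; rewrite mul0r subr0. Qed.

Lemma conjcE a : Num.conj a = conjc a.
Proof.
have [->|a0] := eqVneq a 0; first by rewrite conjC0 conjc0.
by apply: (mulfI a0); transitivity (`|a| ^+ 2); [rewrite normCK|rewrite sqr_normc].
Qed.

Definition rdot x y : R := complex.Re (hdot x y).

Lemma normE (V : normedModType R[i]) (v : V) : `|v| = (rnorm v)%:C.
Proof. by rewrite /rnorm RRe_real // normr_real. Qed.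

Lemma rnorm_ge0 (V : normedModType R[i]) (v : V) : 0 <= rnorm v.
Proof. by rewrite -ler0c -normE normr_ge0. Qed.

Lemma rnorm0 (V : normedModType R[i]) : rnorm (0 : V) = 0.
Proof. by rewrite /rnorm normr0. Qed.

Lemma rnorm_eq0 (V : normedModType R[i]) (v : V) : rnorm v = 0 -> v = 0.
Proof. by move=> v0; apply/eqP; rewrite -normr_eq0 normE v0. Qed.

Lemma rnormZ (V : normedModType R[i]) a (v : V) :
  rnorm (a *: v) = complex.Re `|a| * rnorm v.
Proof. by rewrite /rnorm normrZ normE (normc_def a) /= mul0r subr0. Qed.

Lemma rnormN (V : normedModType R[i]) (v : V) : rnorm (- v) = rnorm v.
Proof. by rewrite /rnorm normrN. Qed.

Lemma rnormB (V : normedModType R[i]) (v w : V) : rnorm (v - w) = rnorm (w - v).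
Proof. by rewrite /rnorm distrC. Qed.

Lemma rnormD (V : normedModType R[i]) (v w : V) :
  rnorm (v + w) <= rnorm v + rnorm w.
Proof.
rewrite -lecR -normE (le_trans (ler_normD _ _))// !normE.
by rewrite [(_ + _)%:C]rmorphD.
Qed.

Lemma rdotDl x y z : rdot (x + y) z = rdot x z + rdot y z.
Proof. by rewrite /rdot linearDl complexReD. Qed.

Lemma rdot_adj a x y : rdot (a *: x) y = rdot x (a^*%C *: y).
Proof. by rewrite /rdot linearZl_LR linearZr_LR /= conjcE conjcK. Qed.

Lemma rdotC x y : rdot x y = rdot y x.
Proof.
rewrite /rdot (hermC hdot x y) expr0 mul1r.
by rewrite /= conjcE; case: (hdot y x : R[i]).
Qed.

Lemma rdotDr x y z : rdot x (y + z) = rdot x y + rdot x z.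
Proof. by rewrite !(rdotC x) rdotDl. Qed.

Lemma rdotZl t x y : rdot (t%:C *: x) y = t * rdot x y.
Proof. by rewrite /rdot linearZl_LR /= complexReZ. Qed.

Lemma rdotZr t x y : rdot x (t%:C *: y) = t * rdot x y.
Proof. by rewrite rdotC rdotZl rdotC. Qed.

Lemma rdotNl x y : rdot (- x) y = - rdot x y.
Proof. by rewrite /rdot linearNl complexReN. Qed.

Lemma rdotNr x y : rdot x (- y) = - rdot x y.
Proof. by rewrite rdotC rdotNl rdotC. Qed.

Lemma rdot0l x : rdot 0 x = 0.
Proof. by rewrite /rdot linear0l. Qed.

Lemma rdotBl x y z : rdot (x - y) z = rdot x z - rdot y z.
Proof. by rewrite rdotDl rdotNl. Qed.

Lemma rdotBr x y z : rdot x (y - z) = rdot x y - rdot x z.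
Proof. by rewrite rdotDr rdotNr. Qed.

Lemma rdot_norm x : rdot x x = rnorm x ^+ 2.
Proof.
by rewrite /rdot -normr_hdot normE -rmorphXn.
Qed.

(** This is what lets real-valued integrals determine the complex form. *)
Lemma complexIm_hdot x y : complex.Im (hdot x y) = rdot x ('i%C *: y).
Proof.
rewrite /rdot linearZr_LR /= conjcE.
by rewrite mulrC -[conjc 'i]/(0 -i* 1); case: (hdot _ _) => u v /=; ring.
Qed.

Lemma rdot_inj x y : (forall z, rdot x z = rdot y z) -> x = y.
Proof.
move=> xy; apply/eqP; rewrite -subr_eq0; apply/eqP/rnorm_eq0/eqP.
by rewrite -sqrf_eq0 -rdot_norm rdotBl xy subrr.
Qed.

(** Cauchy-Schwarz: expand the square of [|y| x - |x| y]. *)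
Lemma rdot_le x y : rdot x y <= rnorm x * rnorm y.
Proof.
have [x0|x0] := eqVneq (rnorm x) 0.
  by rewrite (rnorm_eq0 x0) rdot0l rnorm0 mul0r.
have [y0|y0] := eqVneq (rnorm y) 0.
  by rewrite (rnorm_eq0 y0) rdotC rdot0l rnorm0 mulr0.
have : 0 <= rnorm ((rnorm y)%:C *: x - (rnorm x)%:C *: y) ^+ 2 by exact: sqr_ge0.
rewrite -rdot_norm !(rdotBl, rdotBr, rdotZl, rdotZr) !rdot_norm (rdotC y).
have := rnorm_ge0 x; have := rnorm_ge0 y.
move: (rdot x y) (rnorm x) (rnorm y) x0 y0 => r a b a0 b0 b0' a0'.
have ab : 0 < a * b by rewrite mulr_gt0// lt_def ?a0 ?b0.
have -> : b * (b * a ^+ 2 - a * r) - a * (b * r - a * b ^+ 2) =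
  2 * (a * b) * (a * b - r) by ring.
by rewrite pmulr_rge0 ?subr_ge0// mulr_gt0.
Qed.

(** Test against [y = x]. *)
Lemma rnorm_dual x (c : R) : 0 <= c ->
  (forall y, rdot x y <= c * rnorm y) -> rnorm x <= c.
Proof.
move=> c0 xc; have [->//|x0] := eqVneq (rnorm x) 0.
have {}x0 : 0 < rnorm x by rewrite lt_def x0 rnorm_ge0.
by rewrite -(ler_pM2r x0) -expr2 -rdot_norm.
Qed.

End RealInnerProduct.

(** * Completeness and the Riesz representation *)

Section Completeness.
Set Implicit Arguments.
Unset Strict Implicit.
Unset Printing Implicit Defensive.
Local Open Scope complex_scope.
Context {R : realType} {H : hilbertType R}.
Implicit Types (x y z : H) (a b : R[i]) (t : R).

(** Completeness, with the Cauchy condition and the limit expressed through the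
  real-valued norm. *)
Lemma rnorm_complete (u : nat -> H) :
  (forall e : R, 0 < e -> exists N, forall n m, (N <= n)%N -> (N <= m)%N ->
     rnorm (u n - u m) < e) ->
  exists l, forall e : R, 0 < e -> exists N, forall n, (N <= n)%N ->
     rnorm (l - u n) < e.
Proof.
move=> uC; have cu : cvgn u.
  apply/cauchy_cvgP/cauchy_ballP => e e0.
  move: e0; rewrite ltcE /= => /andP[/eqP e_real e0].
  have [N NP] := uC _ e0.
  exists (u @` [set n | (N <= n)%N], u @` [set n | (N <= n)%N]).
    by split; exists N => // n Nn; exists n.
  move=> _ [/= [n Nn <-] [m Nm <-]]; rewrite -ball_normE /= normE.
  by rewrite ltcE /= e_real eqxx NP.
exists (limn u) => e e0.
move/cvgrPdist_lt : cu => /(_ e%:C); rewrite ltcR => /(_ e0) [N _ NP].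
by exists N => n /NP /=; rewrite normE ltcR.
Qed.

(** A discriminant condition: optimise a family of weighted arithmetic-geometric
  mean inequalities in its weight.  It turns Young-type bounds into
  Cauchy-Schwarz ones without dividing by norms that may vanish. *)
Lemma quadratic_le (a b c : R) : 0 <= a -> 0 <= c ->
  (forall t : R, 0 < t -> 2 * b * t <= a ^+ 2 * t ^+ 2 + c ^+ 2) -> b <= a * c.
Proof.
move=> a0 c0 abc.
have [b0|b0] := leP b 0; first by rewrite (le_trans b0)// mulr_ge0.
have [aE|aN0] := eqVneq a 0.
  have := abc ((c ^+ 2 + 1) / (2 * b)).
  rewrite divr_gt0 ?mulr_gt0 ?ltr_pwDr ?sqr_ge0// => /(_ isT).
  have -> : 2 * b * ((c ^+ 2 + 1) / (2 * b)) = c ^+ 2 + 1.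
    by field; rewrite gt_eqF.
  by rewrite aE expr0n mul0r add0r; lra.
(* The hypothesis is sharpest at [t = b / a ^ 2]. *)
have a2 : 0 < a ^+ 2 by rewrite exprn_gt0// lt_def aN0.
have := abc (b / a ^+ 2); rewrite divr_gt0// => /(_ isT).
have -> : a ^+ 2 * (b / a ^+ 2) ^+ 2 = b ^+ 2 / a ^+ 2 by field.
have -> : 2 * b * (b / a ^+ 2) = b ^+ 2 / a ^+ 2 + b ^+ 2 / a ^+ 2 by field.
rewrite lerD2l ler_pdivrMr// -exprMn ler_pXn2r ?nnegrE ?mulr_ge0//; last exact: ltW.
by rewrite mulrC.
Qed.

(** Riesz representation, for a bounded real-linear functional.  The representing
  vector minimises [J x = |x|^2 - 2 psi x]: the parallelogram identity makes every
  minimising sequence Cauchy, and the variation of [J] in the direction of [y]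
  shows that [rdot x y - psi y] is small when [J x] is nearly minimal.  Both
  facts are used for approximate minimisers only, so that the continuity of [J]
  and [psi] never enters. *)
Lemma riesz (psi : H -> R) (C : R) :
  (forall x y, psi (x + y) = psi x + psi y) ->
  (forall t x, psi (t%:C *: x) = t * psi x) ->
  (forall x, psi x <= C * rnorm x) ->
  exists x, forall y, rdot x y = psi y.
Proof.
move=> psiD psiZ psiC; pose J x := rnorm x ^+ 2 - 2 * psi x.
have Jlb x : - C ^+ 2 <= J x.
  rewrite /J; have := psiC x; have := sqr_ge0 (rnorm x - C); nra.
have Jinf : has_inf (range J).
  by split; [exists (J 0), 0|exists (- C ^+ 2) => _ [x _ <-]].
pose d := inf (range J).
have Jd x : d <= J x by apply: ge_inf; [exact: Jinf.2|exists x].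
have close e x y : 0 < e -> J x < d + e ^+ 2 -> J y < d + e ^+ 2 ->
    rnorm (x - y) <= 2 * e.
  move=> e0 Jx Jy.
  (* The parallelogram identity; [psi] cancels because it is additive. *)
  have E : rnorm (x - y) ^+ 2 = 2 * (J x + J y) - 4 * J (2^-1%:C *: (x + y)).
    rewrite /J -!rdot_norm !(rdotBl, rdotBr, rdotZl, rdotZr, rdotDl, rdotDr).
    by rewrite psiZ psiD (rdotC y x); field.
  have := Jd (2^-1%:C *: (x + y)) => Jm.
  rewrite -(@ler_pXn2r _ 2)// ?nnegrE ?rnorm_ge0//; last by rewrite mulr_ge0// ltW.
  by rewrite E exprMn; lra.
have crit e x y : 0 < e -> J x < d + e ^+ 2 ->
    rdot x y - psi y <= rnorm y * e.
  move=> e0 Jx; apply: quadratic_le; [exact: rnorm_ge0|exact: ltW|move=> t _].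
  have := Jd (x + (- t)%:C *: y).
  rewrite {1}/J -rdot_norm !(rdotZl, rdotZr, rdotDl, rdotDr) psiD psiZ.
  rewrite !rdot_norm (rdotC y x) => Jt.
  by move: Jx; rewrite /J; nra.
pose e n : R := n.+1%:R^-1.
have e0 n : 0 < e n by rewrite invr_gt0.
have /choice [u uJ] : forall n, exists x, J x < d + e n ^+ 2.
  move=> n; have [_ [x _ <-] Jx] := inf_adherent (exprn_gt0 2 (e0 n)) Jinf.
  by exists x.
have eN (r : R) : 0 < r -> exists N, forall n, (N <= n)%N -> e n < r.
  move=> r0.
  have : e @ \oo --> 0 by exact: cvg_harmonic.
  move/cvgrPdist_lt => /(_ r r0) [N _ NP]; exists N => n /NP /=.
  by rewrite sub0r normrN ger0_norm// ltW.
have uJN r : 0 < r -> exists N, forall n, (N <= n)%N -> J (u n) < d + r ^+ 2.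
  move=> r0; have [N NP] := eN r r0; exists N => n /NP er.
  rewrite (lt_le_trans (uJ n))// lerD2l.
  by rewrite ler_pXn2r ?nnegrE ?(ltW (e0 n)) ?(ltW r0) ?(ltW er).
have [|l ul] := @rnorm_complete u.
  move=> r r0; have [|N NP] := uJN (r / 4); first by rewrite divr_gt0.
  exists N => n m /NP Jn /NP Jm.
  have := @close (r / 4) _ _ _ Jn Jm; rewrite divr_gt0// => /(_ isT).
  by lra.
have lle y : rdot l y - psi y <= 0.
  have [y0|y0] := eqVneq (rnorm y) 0.
    have := @crit (e 0%N) (u 0%N) y (e0 _) (uJ _).
    by rewrite (rnorm_eq0 y0) !(rdotC _ 0) !rdot0l rnorm0 mul0r.
  have {}y0 : 0 < rnorm y by rewrite lt_def y0 rnorm_ge0.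
  apply/ler_addgt0Pr => r r0; rewrite add0r.
  have r1 : 0 < r / (2 * rnorm y) by rewrite divr_gt0// mulr_gt0.
  have [N1 NP1] := ul _ r1; have [N2 NP2] := uJN _ r1.
  pose n := maxn N1 N2.
  have := NP1 n (leq_maxl _ _); have := @crit _ _ y r1 (NP2 n (leq_maxr _ _)).
  have := rdot_le (l - u n) y; rewrite rdotBl.
  have -> : rnorm y * (r / (2 * rnorm y)) = r / 2 by field; rewrite gt_eqF.
  rewrite ltr_pdivlMr ?mulr_gt0//; lra.
exists l => y; apply/eqP; rewrite eq_le -subr_le0 lle /=.
have := lle (- y); rewrite rdotNr.
have -> : psi (- y) = - psi y.
  have := psiD y (- y); rewrite subrr.
  have := psiZ 0 y; rewrite mul0r -[0%:C]/(0 : R[i]) scale0r => ->; lra.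
lra.
Qed.

End Completeness.

(** * Coercive operators *)

Section Operators.
Set Implicit Arguments.
Unset Strict Implicit.
Unset Printing Implicit Defensive.
Local Open Scope complex_scope.
Context {R : realType}.
Implicit Types H K : hilbertType R.

Lemma linear_add (U V : lmodType R[i]) (T : U -> V) : linear T ->
  forall x y, T (x + y) = T x + T y.
Proof. by move=> lT x y; rewrite -[x in LHS]scale1r lT scale1r. Qed.

Lemma linear_zero (U V : lmodType R[i]) (T : U -> V) : linear T -> T 0 = 0.
Proof.
by move=> lT; apply: (addrI (T 0)); rewrite -linear_add// !addr0.
Qed.

Lemma linear_scale (U V : lmodType R[i]) (T : U -> V) : linear T ->
  forall a x, T (a *: x) = a *: T x.
Proof.
by move=> lT a x; rewrite -[a *: x]addr0 lT linear_zero// addr0.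
Qed.

Lemma linear_sub (U V : lmodType R[i]) (T : U -> V) : linear T ->
  forall x y, T (x - y) = T x - T y.
Proof.
by move=> lT x y; rewrite linear_add// -scaleN1r linear_scale// scaleN1r.
Qed.

(** Banach's fixed point theorem.  The iterates of [0] stay in the ball of radius
  [D = |F 0| / (1 - q)], which [F] maps into itself; hence
  [|u (n + k) - u n| <= q ^ n |u k - u 0| <= q ^ n D]. *)
Lemma contraction_fixpoint H (q : R) (F : H -> H) : 0 <= q -> q < 1 ->
  (forall x y, rnorm (F x - F y) <= q * rnorm (x - y)) -> exists x, F x = x.
Proof.
move=> q0 q1 FB; pose u n := iter n F 0.
pose D := rnorm (F 0) / (1 - q).
have FD : rnorm (F 0) = (1 - q) * D by rewrite /D mulrC divfK// subr_eq0 gt_eqF.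
have D0 : 0 <= D by rewrite divr_ge0 ?rnorm_ge0// subr_ge0 ltW.
have uD k : rnorm (u k) <= D.
  elim: k => [|k IH]; first by rewrite /u /= rnorm0.
  rewrite -[u _]/(F (u k)) -(subrK (F 0) (F _)) (le_trans (rnormD _ _))// FD.
  have := FB (u k) 0; rewrite subr0.
  by have := ler_wpM2l q0 IH; lra.
have uk n k : rnorm (u (n + k)%N - u n) <= q ^+ n * D.
  elim: n => [|n IH]; first by rewrite add0n subr0 expr0 mul1r.
  by rewrite exprS -mulrA (le_trans (FB _ _))// ler_wpM2l.
have qN e : 0 < e -> exists N, forall n, (N <= n)%N -> q ^+ n * D < e.
  move=> e0; have e1 : 0 < e / (D + 1) by rewrite divr_gt0// ltr_pwDr.
  have : (q ^+ n @[n --> \oo] --> 0)%R by apply: cvg_expr; rewrite ger0_norm.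
  move/cvgrPdist_lt => /(_ _ e1) [N _ NP]; exists N => n /NP /=.
  rewrite sub0r normrN ger0_norm ?exprn_ge0// ltr_pdivlMr ?ltr_pwDr//.
  by apply: le_lt_trans; rewrite ler_wpM2l ?exprn_ge0// lerDl.
have [e e0|l ul] := @rnorm_complete _ _ u.
  have [|N NP] := qN (e / 2); first by rewrite divr_gt0.
  exists N => n m Nn Nm.
  have := rnormD (u n - u N) (u N - u m); rewrite addrA subrK.
  have := uk N (n - N)%N; have := uk N (m - N)%N; have := NP N (leqnn _).
  by rewrite !subnKC// (rnormB (u N)); lra.
exists l; apply/eqP; rewrite -subr_eq0; apply/eqP/rnorm_eq0/eqP.
rewrite eq_le rnorm_ge0 andbT; apply/ler_addgt0Pr => e e0; rewrite add0r.
have [|N NP] := ul (e / 2); first by rewrite divr_gt0.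
have := rnormD (F l - u N.+1) (u N.+1 - l); rewrite addrA subrK (rnormB (u N.+1) l).
have := NP N (leqnn _); have := NP N.+1 (leqnSn _); have := FB l (u N).
rewrite -[F (u N)]/(u N.+1); 
have := ler_piMl (rnorm_ge0 (l - u N)) (ltW q1); lra.
Qed.

Definition coercive H (c : R) (T : H -> H) :=
  forall x, c * rnorm x ^+ 2 <= rdot (T x) x.

Lemma coercive_bounded_below H (c : R) (T : H -> H) x :
  coercive c T -> c * rnorm x <= rnorm (T x).
Proof.
move=> cT; have [x0|x0] := eqVneq (rnorm x) 0.
  by rewrite x0 mulr0 rnorm_ge0.
have {}x0 : 0 < rnorm x by rewrite lt_def x0 rnorm_ge0.
rewrite -(ler_pM2r x0) -mulrA -expr2.
exact: le_trans (cT x) (rdot_le _ _).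
Qed.

(** The Lax-Milgram argument: for [t] small, [x |-> x - t (T x - y)] is a
  contraction, and its fixed point solves [T x = y]. *)
Lemma coercive_surj H (c : R) (T : H -> H) : 0 < c -> bounded_operator T ->
  coercive c T -> forall y, exists x, T x = y.
Proof.
move=> c0 [lT [N TN]] cT y.
(* Enlarging the bound of [T] to [L >= c > 0] makes [c / L] a number in [0, 1]. *)
pose L := Num.max N c.
have cL : c <= L by rewrite le_max lexx orbT.
have L0 : 0 < L by exact: lt_le_trans cL.
have TL x : rnorm (T x) <= L * rnorm x.
  by rewrite (le_trans (TN x))// ler_wpM2r ?rnorm_ge0// le_max lexx.
(* [t] minimises [1 - 2 t c + t ^ 2 L ^ 2], a bound on the squared Lipschitz
   constant; the minimum is [q ^ 2]. *)
pose t := c / L ^+ 2; pose q := Num.sqrt (1 - (c / L) ^+ 2).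
have cL1 : (c / L) ^+ 2 <= 1.
  by rewrite exprn_ile1// ?divr_ge0 ?(ltW c0) ?(ltW L0)// ler_pdivrMr// mul1r.
have q0 : 0 <= q by exact: sqrtr_ge0.
have q2 : q ^+ 2 = 1 - (c / L) ^+ 2 by rewrite sqr_sqrtr// subr_ge0.
have q1 : q < 1.
  rewrite -(@ltr_pXn2r _ 2)// ?nnegrE// q2 expr1n gtrDl oppr_lt0.
  by rewrite exprn_gt0// divr_gt0.
pose F x := (x - t%:C *: T x) + t%:C *: y.
have FB x x' : rnorm (F x - F x') <= q * rnorm (x - x').
  have -> : F x - F x' = (x - x') - t%:C *: T (x - x').
    rewrite (linear_sub lT) scalerBr /F opprD addrACA subrr addr0.
    by rewrite [in RHS]opprD addrACA -opprD.
  move: (x - x') => z.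
  rewrite -(@ler_pXn2r _ 2)// ?nnegrE ?rnorm_ge0//; last first.
    by rewrite mulr_ge0// rnorm_ge0.
  rewrite exprMn q2 -rdot_norm !(rdotBl, rdotBr, rdotZl, rdotZr).
  rewrite !rdot_norm (rdotC z).
  have t0 : 0 < t by rewrite divr_gt0// exprn_gt0.
  have TL2 : rnorm (T z) ^+ 2 <= L ^+ 2 * rnorm z ^+ 2.
    by rewrite -exprMn ler_pXn2r// ?nnegrE ?mulr_ge0 ?rnorm_ge0// ltW.
  have E1 : t ^+ 2 * L ^+ 2 = (c / L) ^+ 2 by rewrite /t; field; rewrite gt_eqF.
  have E2 : t * c = (c / L) ^+ 2 by rewrite /t; field; rewrite gt_eqF.
  have := ler_wpM2l (sqr_ge0 t) TL2; have := ler_wpM2l (ltW t0) (cT z).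
  rewrite [t * (c * _)]mulrA E2 [t ^+ 2 * (L ^+ 2 * _)]mulrA E1.
  by move: ((c / L) ^+ 2) => k; lra.
have [x xF] := contraction_fixpoint q0 q1 FB.
have t0 : t%:C != 0.
  by rewrite -[0]/(0%:C) (inj_eq (@complexI _)) gt_eqF// divr_gt0// exprn_gt0.
exists x; apply: (scalerI t0).
move/eqP: xF; rewrite /F -addrA -subr_eq0 addrAC subrr add0r addrC subr_eq0.
by move=> /eqP ->.
Qed.

Lemma coercive_inj H (c : R) (T : H -> H) : 0 < c -> linear T ->
  coercive c T -> injective T.
Proof.
move=> c0 lT cT x y xy; apply/eqP; rewrite -subr_eq0; apply/eqP/rnorm_eq0.
apply/eqP; rewrite eq_le rnorm_ge0 andbT -(pmulr_rle0 _ c0).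
by rewrite (le_trans (coercive_bounded_below _ cT))// linear_sub// xy subrr rnorm0.
Qed.

Lemma coercive_opinv H (c : R) (T : H -> H) : 0 < c -> bounded_operator T ->
  coercive c T -> cancel T (opinv T) /\ cancel (opinv T) T.
Proof.
move=> c0 bT cT; split=> x.
  by apply: pinvKV; rewrite ?inE// => y z _ _; exact: (coercive_inj c0 bT.1 cT).
apply: pinvK; rewrite inE /=; have [y Ty] := coercive_surj c0 bT cT x.
by exists y.
Qed.

Lemma rnorm_opinv_le H (c : R) (T : H -> H) x : 0 < c -> bounded_operator T ->
  coercive c T -> rnorm (opinv T x) <= 1 / c * rnorm x.
Proof.
move=> c0 bT cT; have [_ TK] := coercive_opinv c0 bT cT.
have := coercive_bounded_below (opinv T x) cT.
by rewrite TK div1r ler_pdivlMl.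
Qed.

Lemma coercive_GL H (c : R) (T : H -> H) : 0 < c -> bounded_operator T ->
  coercive c T -> GL T.
Proof.
move=> c0 bT cT; have [KT TK] := coercive_opinv c0 bT cT.
split => //; exists (opinv T); split=> //; split.
  by move=> a x y; apply: (can_inj KT); rewrite bT.1 !TK.
by exists (1 / c) => x; exact: rnorm_opinv_le.
Qed.

Lemma opnorm_le H K (T : H -> K) (c : R) :
  (forall x, rnorm (T x) <= c * rnorm x) -> 0 <= c -> (opnorm T <= c%:E)%E.
Proof.
move=> Tc c0; apply: ge_ereal_sup => _ [x /= x1 <-]; rewrite lee_fin.
by rewrite (le_trans (Tc x))// ler_piMr.
Qed.

Lemma opnorm_ge0 H K (T : H -> K) : (0 <= opnorm T)%E.
Proof.
apply: (@le_trans _ _ (rnorm (T 0))%:E); first by rewrite lee_fin rnorm_ge0.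
by apply: ereal_sup_ubound; exists 0 => //=; rewrite rnorm0.
Qed.

(** ** Neumann series of a perturbed coercive operator *)

Section Perturbation.
Variables (H : hilbertType R) (M M0 : H -> H) (c delta : R).
Hypotheses (bM : bounded_operator M) (bM0 : bounded_operator M0).
Hypotheses (delta_ge0 : 0 <= delta) (delta_lt : delta < c).
Hypothesis cM0 : coercive c M0.
Hypothesis M0M : forall x, rnorm (M0 x - M x) <= delta * rnorm x.

Let c_gt0 : 0 < c. Proof. exact: le_lt_trans delta_lt. Qed.
Let T := opinv M0 \o (M0 \- M).
Let q := delta / c.

Lemma coercive_perturbation : coercive (c - delta) M.
Proof.
move=> x; have -> : M x = M0 x - (M0 x - M x) by rewrite subKr.
rewrite rdotBl; have := rdot_le (M0 x - M x) x.
have := ler_wpM2r (rnorm_ge0 x) (M0M x); have := cM0 x; lra.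
Qed.

Lemma perturbation_sub n x y : iter n T (x - y) = iter n T x - iter n T y.
Proof.
elim: n => //= n ->; apply: (can_inj (coercive_opinv c_gt0 bM0 cM0).1).
have [_ K] := coercive_opinv c_gt0 bM0 cM0.
rewrite /T /= !(linear_sub bM0.1) !K (linear_sub bM.1).
by rewrite !opprD !opprK addrACA.
Qed.

Lemma perturbation_iter_le n x : rnorm (iter n T x) <= q ^+ n * rnorm x.
Proof.
elim: n => [|n IH] /=; first by rewrite expr0 mul1r.
rewrite exprS -mulrA (le_trans (rnorm_opinv_le _ c_gt0 bM0 cM0))//=.
rewrite {1}/q div1r (mulrC delta) -mulrA ler_wpM2l ?invr_ge0 ?(ltW c_gt0)//.
by rewrite (le_trans (M0M _))// ler_wpM2l.
Qed.

(** The remainder of the series is explicit: [opinv M0 f = x - T x] for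
  [x = opinv M f], so the partial sums telescope. *)
Lemma neumann_remainder n f :
  opinv M f - \sum_(0 <= k < n) iter k T (opinv M0 f) = iter n T (opinv M f).
Proof.
have cd : 0 < c - delta by rewrite subr_gt0.
have [_ MK] := coercive_opinv cd bM coercive_perturbation.
have [M0K _] := coercive_opinv c_gt0 bM0 cM0.
have TE : T (opinv M f) = opinv M f - opinv M0 f.
  apply: (can_inj (coercive_opinv c_gt0 bM0 cM0).1).
  have [_ K] := coercive_opinv c_gt0 bM0 cM0.
  by rewrite /T /= !(linear_sub bM0.1) !K MK.
elim: n => [|n IH]; first by rewrite big_geq// subr0.
by rewrite big_nat_recr//= opprD addrA IH -perturbation_sub -TE -iterSr.
Qed.

Lemma neumann_remainder_le n f :
  rnorm (opinv M f - \sum_(0 <= k < n) iter k T (opinv M0 f)) <=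
  q ^+ n * (1 / (c - delta)) * rnorm f.
Proof.
have cd : 0 < c - delta by rewrite subr_gt0.
rewrite neumann_remainder (le_trans (perturbation_iter_le _ _))// -mulrA.
rewrite ler_wpM2l ?exprn_ge0 ?divr_ge0 ?(ltW c_gt0)//.
exact: rnorm_opinv_le coercive_perturbation.
Qed.

Let S n : H -> H := fun f => \sum_(0 <= k < n) iter k T (opinv M0 f).

Lemma opnorm_neumann_remainder_le n :
  (opnorm (opinv M \- S n)%R <= (q ^+ n * (1 / (c - delta)))%:E)%E.
Proof.
apply: opnorm_le => [f|]; first exact: neumann_remainder_le.
by rewrite mulr_ge0 ?exprn_ge0 ?divr_ge0 ?(ltW c_gt0) ?subr_ge0 ?(ltW delta_lt).
Qed.

Lemma opnorm_neumann_remainder_cvg :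
  (fun n => opnorm (opinv M \- S n)%R) @ \oo --> 0%E.
Proof.
apply: (@squeeze_cvge _ _ _ _ (cst 0%E) _
  (fun n => (q ^+ n * (1 / (c - delta)))%:E)).
- apply: nearW => n; rewrite opnorm_ge0 /=.
  exact: opnorm_neumann_remainder_le.
- exact: cvg_cst.
- apply: cvg_EFin; first exact: nearW.
  rewrite -[X in _ --> X](mul0r (1 / (c - delta))).
  apply: cvgM; last exact: cvg_cst.
  by apply: cvg_expr; rewrite ger0_norm ?divr_ge0 ?(ltW c_gt0)// ltr_pdivrMr// mul1r.
Qed.

End Perturbation.

End Operators.

(** * Strongly measurable families *)

Section StrongMeasurability.
Set Implicit Arguments.
Unset Strict Implicit.
Unset Printing Implicit Defensive.
Local Open Scope complex_scope.
Context {R : realType} {d : measure_display} {Omega : measurableType d}.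
Context {K : Omega -> hilbertType R}.
Implicit Types F G : forall w, K w.

(** Sections of the direct sum at different points are orthogonal, so strong
  measurability says much more than for maps into a fixed space: every subset of
  the support is measurable.  This is all that is used of it below, and it passes
  to differences without any separability assumption. *)
Definition support_discrete F :=
  forall S : set Omega, (forall w, S w -> F w <> 0) -> measurable S.

Lemma hsum_injE w (v : K w) : hsum_inj v w = v.
Proof. by rewrite /hsum_inj eqtype.dfwith_in. Qed.

Lemma hsum_inj_neq w (v : K w) w' : hsum_inj v w' <> 0 -> w' = w.
Proof.
apply: contra_notP => /eqP ww'; rewrite /hsum_inj eqtype.dfwith_out//.
by rewrite eq_sym.
Qed.

Lemma hsum_inj_hsum w (v : K w) : hsum (hsum_inj v).
Proof.
rewrite /hsum /= /l2norm2.
suff -> : (\esum_(w' in [set: Omega]) (rnorm (hsum_inj v w') ^+ 2)%:E =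
    \esum_(w' in [set w]) (rnorm (hsum_inj v w') ^+ 2)%:E)%E.
  by rewrite esum_set1 ?ltry// lee_fin sqr_ge0.
rewrite [RHS]esum_mkcond; apply: eq_esum => w' _.
case: ifPn => //; rewrite notin_setE /= => ww'.
have -> : hsum_inj v w' = 0 by apply: contrapT => /hsum_inj_neq.
by rewrite rnorm0 expr0n.
Qed.

(** For any set [S] of points, the vectors of the direct sum with a nonzero
  coordinate in [S] form an open set. *)
Lemma strongly_measurable_discrete F :
  strongly_measurable F -> support_discrete F.
Proof.
move=> mF S SF.
pose U := [set x : forall w, K w | hsum x /\ exists2 w, S w & x w <> 0].
have -> : S = [set w | U (hsum_inj (F w))].
  apply/seteqP; split=> w /=.
    move=> Sw; split; first exact: hsum_inj_hsum.
    by exists w => //; rewrite hsum_injE; exact: SF.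
  by move=> [_ [w' Sw' /hsum_inj_neq <-]].
apply: mF; apply: sub_gen_smallest; split=> [x []//|x [_ [w Sw xw]]].
have xw0 : 0 < rnorm (x w).
  by rewrite lt_def rnorm_ge0 andbT; apply/eqP => /rnorm_eq0.
exists (rnorm (x w)) => // y hy yx; split=> //; exists w => // yw.
move: yx; apply/negP; rewrite -leNgt /l2norm2.
apply: esum_ge; exists [set w]; first by split.
by rewrite fsbig_set1 yw sub0r rnormN.
Qed.

Lemma support_discrete_sub F G : support_discrete F -> support_discrete G ->
  support_discrete (fun w => F w - G w).
Proof.
move=> dF dG S SFG.
have -> : S = [set w | S w /\ F w <> 0] `|` [set w | S w /\ G w <> 0].
  apply/seteqP; split=> [w Sw|w [[]|[]]//] /=.
  have [Fw|Fw] := pselect (F w = 0); last by left.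
  by right; split=> // Gw; apply: (SFG _ Sw); rewrite Fw Gw subr0.
by apply: measurableU; [apply: dF => w []|apply: dG => w []].
Qed.

(** The preimage of a set avoiding [0] is a subset of the support; otherwise the
  preimage of its complement is. *)
Lemma support_discrete_measurable F (h : Omega -> R) : support_discrete F ->
  (forall w, F w = 0 -> h w = 0) -> measurable_fun [set: Omega] h.
Proof.
move=> dF h0 _ Y mY; rewrite setTI.
have [Y0|Y0] := pselect (Y 0).
  rewrite -[X in measurable X]setCK; apply: measurableC.
  by apply: dF => w /= hw /h0 hw0; apply: hw; rewrite hw0.
by apply: dF => w /= hw /h0 hw0; apply: Y0; rewrite -hw0.
Qed.

End StrongMeasurability.

(** * The form of a multiplier *)

Section Multipliers.
Set Implicit Arguments.
Unset Strict Implicit.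
Unset Printing Implicit Defensive.
Local Open Scope complex_scope.
Context {R : realType} {d : measure_display} {Omega : measurableType d}.
Variable mu : {measure set Omega -> \bar R}.
Context {H : hilbertType R} {K : Omega -> hilbertType R}.
Implicit Types (F G : forall w, K w) (Lambda Theta : forall w, H -> K w).
Implicit Types m : Omega -> R[i].

(** The real part of [m <F, G>]: the scalar [m] is moved onto [F] so that the
  real inner product applies. *)
Definition mform m F G : Omega -> R := fun w => rdot (m w *: F w) (G w).

Lemma mform_measurable m F G : support_discrete F ->
  measurable_fun [set: Omega] (mform m F G).
Proof.
move=> dF; apply: (support_discrete_measurable dF) => w Fw.
by rewrite /mform Fw scaler0 rdot0l.
Qed.

Lemma rnorm2_measurable F : support_discrete F ->
  measurable_fun [set: Omega] (fun w => rnorm (F w) ^+ 2).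
Proof.
move=> dF; apply: (support_discrete_measurable dF) => w ->.
by rewrite rnorm0 expr0n.
Qed.

Section Estimate.
Variables (m : Omega -> R[i]) (c : R) (F G : forall w, K w) (a b : R).
Hypothesis m_le : {ae mu, forall w, complex.Re `|m w| <= c}.
Hypotheses (dF : support_discrete F) (dG : support_discrete G).
Hypotheses (c_ge0 : 0 <= c) (a_ge0 : 0 <= a) (b_ge0 : 0 <= b).
Hypothesis F_le : (\int[mu]_w (rnorm (F w) ^+ 2)%:E <= (a ^+ 2)%:E)%E.
Hypothesis G_le : (\int[mu]_w (rnorm (G w) ^+ 2)%:E <= (b ^+ 2)%:E)%E.

(** Pointwise, [2 t |m <F, G>| <= (c t |F|)^2 + |G|^2].  Keeping the weight on [F]
  avoids division by [t]. *)
Lemma mform_young t : 0 < t ->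
  (\int[mu]_w (2 * t * `|mform m F G w|)%:E <=
   ((c * a) ^+ 2 * t ^+ 2 + b ^+ 2)%:E)%E.
Proof.
move=> t0; have ct0 : 0 <= (c * t) ^+ 2 by exact: sqr_ge0.
apply: (@le_trans _ _ (\int[mu]_w
    (((c * t) ^+ 2)%:E * (rnorm (F w) ^+ 2)%:E + (rnorm (G w) ^+ 2)%:E))%E).
  apply: ae_ge0_le_integral => //=.
  - by move=> w _; rewrite lee_fin !mulr_ge0// ltW.
  - apply/measurable_EFinP; apply: measurable_funM => //.
    by apply: measurableT_comp => //; exact: mform_measurable.
  - move=> w _; apply: adde_ge0.
      by rewrite -EFinM lee_fin mulr_ge0// sqr_ge0.
    by rewrite lee_fin sqr_ge0.
  - under eq_fun do rewrite -EFinM -EFinD.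
    apply/measurable_EFinP; apply: measurable_funD; last exact: rnorm2_measurable.
    by apply: measurable_funM => //; exact: rnorm2_measurable.
  apply: filterS m_le => w mw _; rewrite -EFinM -EFinD lee_fin /mform.
  have le_rdot : `|rdot (m w *: F w) (G w)| <= c * rnorm (F w) * rnorm (G w).
    have cF : rnorm (m w *: F w) <= c * rnorm (F w).
      by rewrite rnormZ ler_wpM2r// rnorm_ge0.
    have h := ler_wpM2r (rnorm_ge0 (G w)) cF.
    rewrite ler_norml lerNl -rdotNl !(le_trans (rdot_le _ _))// rnormN//.
  have := sqr_ge0 (c * t * rnorm (F w) - rnorm (G w)).
  have := ler_wpM2l (ltW t0) le_rdot.
  move: (`|rdot _ _|) (rnorm (F w)) (rnorm (G w)) => x y z; nra.
rewrite ge0_integralD//=.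
- rewrite ge0_integralZl//=.
  + rewrite EFinD (_ : (c * a) ^+ 2 * t ^+ 2 = (c * t) ^+ 2 * a ^+ 2); last by ring.
    by apply: leeD => //; rewrite [leRHS]EFinM; exact: lee_wpmul2l.
  + by apply/measurable_EFinP; exact: rnorm2_measurable.
  + by move=> w _; rewrite lee_fin sqr_ge0.
- by move=> w _; rewrite -EFinM lee_fin mulr_ge0// sqr_ge0.
- under eq_fun do rewrite -EFinM.
  by apply/measurable_EFinP; apply: measurable_funM => //; exact: rnorm2_measurable.
- by move=> w _; rewrite lee_fin sqr_ge0.
- by apply/measurable_EFinP; exact: rnorm2_measurable.
Qed.

Lemma mform_integrable : mu.-integrable [set: Omega] (EFin \o mform m F G).
Proof.
apply/integrableP; split.
  by apply/measurable_EFinP; exact: mform_measurable.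
have := @mform_young (2^-1) _; rewrite mulfV// invr_gt0 ltr0n => /(_ isT).
under eq_integral do rewrite mul1r.
by move=> /le_lt_trans; apply; rewrite ltry.
Qed.

(** Cauchy-Schwarz, by optimising the weight in [mform_young]. *)
Lemma mform_integral_le : \int[mu]_w mform m F G w <= c * a * b.
Proof.
apply: quadratic_le; rewrite ?mulr_ge0// => t t0.
rewrite -lee_fin (le_trans _ (mform_young t0))//.
rewrite mulrAC -RintegralZl//; last exact: mform_integrable.
rewrite /Rintegral fineK; last first.
  apply: integrable_fin_num => //.
  by under eq_fun do rewrite EFinM; exact: (integrableZl _ _ mform_integrable).
apply: (le_trans (lee_abs _)); apply: (le_trans (le_abse_integral _ _ _)) => //.
  by apply/measurable_EFinP; apply: measurable_funM => //; exact: mform_measurable.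
under eq_integral => w _.
  rewrite abse_EFin normrM ger0_norm ?mulr_ge0 ?(ltW t0)//; over.
by [].
Qed.

End Estimate.
End Multipliers.

Section MultiplierExistence.
Set Implicit Arguments.
Unset Strict Implicit.
Unset Printing Implicit Defensive.
Local Open Scope complex_scope.
Context {R : realType} {d : measure_display} {Omega : measurableType d}.
Variable mu : {measure set Omega -> \bar R}.
Context {H : hilbertType R} {K : Omega -> hilbertType R}.
Variables (m : Omega -> R[i]) (Lambda Theta : forall w, H -> K w) (N : R).
Hypothesis lLambda : forall w, linear (Lambda w).
Hypothesis lTheta : forall w, linear (Theta w).

Local Notation form f g :=
  (mform m (fun w => Theta w f) (fun w => Lambda w g)).

Hypothesis form_int : forall f g,
  mu.-integrable [set: Omega] (EFin \o form f g).
Hypothesis N_ge0 : 0 <= N.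
Hypothesis form_le : forall f g,
  \int[mu]_w form f g w <= N * rnorm f * rnorm g.

Lemma is_multiplierP (M : H -> H) : bounded_operator M ->
  (forall f g, rdot (M f) g = \int[mu]_w form f g w) ->
  is_multiplier mu m Lambda Theta M.
Proof.
move=> bM MP; split=> // f g.
have ReE w : complex.Re (multiplier_integrand m Lambda Theta f g w) = form f g w.
  by rewrite /multiplier_integrand /mform /rdot linearZl_LR.
have ImE w : complex.Im (multiplier_integrand m Lambda Theta f g w) =
    form f ('i%C *: g) w.
  by rewrite /mform (linear_scale (lLambda w)) -[RHS]complexIm_hdot linearZl_LR.
split; first split.
- by apply: eq_integrable (form_int f g) => // w _ /=; rewrite ReE.
- by apply: eq_integrable (form_int f ('i%C *: g)) => // w _ /=; rewrite ImE.
apply/eqP; rewrite eq_complex /cintegral; apply/andP; split; apply/eqP => /=.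
  by rewrite -[LHS]/(rdot (M f) g) MP; apply: eq_Rintegral => w _; rewrite ReE.
by rewrite complexIm_hdot MP; apply: eq_Rintegral => w _; rewrite ImE.
Qed.

(** For each [f], the form is a bounded real-linear functional of [g].  The
  representing vector depends complex-linearly on [f]: in the real inner product
  a scalar acting on [f] can be moved to [g] as its conjugate. *)
Lemma form_opE : exists2 M : H -> H, bounded_operator M &
  forall f g, rdot (M f) g = \int[mu]_w form f g w.
Proof.
have /choice[M MP] : forall f, exists Mf,
    forall g, rdot Mf g = \int[mu]_w form f g w.
  move=> f; apply: (@riesz _ _ _ (N * rnorm f)) => [x y|t x|x].
  - rewrite -RintegralD//; apply: eq_Rintegral => w _.
    by rewrite /mform (linear_add (lLambda w)) rdotDr.
  - rewrite -RintegralZl//; apply: eq_Rintegral => w _.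
    by rewrite /mform (linear_scale (lLambda w)) rdotZr.
  - exact: form_le.
exists M => //; split.
  move=> a x y; apply: rdot_inj => z.
  rewrite rdotDl rdot_adj !MP -RintegralD//; apply: eq_Rintegral => w _.
  rewrite /mform lTheta scalerDr rdotDl scalerA mulrC -scalerA rdot_adj.
  by rewrite (linear_scale (lLambda w)).
exists N => f; apply: rnorm_dual => [|g]; first by rewrite mulr_ge0 ?rnorm_ge0.
by rewrite MP.
Qed.

Lemma multiplier_spec (M := multiplier mu m Lambda Theta) :
  is_multiplier mu m Lambda Theta M /\
  forall f g, rdot (M f) g = \int[mu]_w form f g w.
Proof.
have [M' bM' M'E] := form_opE.
have MP : is_multiplier mu m Lambda Theta M.
  apply: (@xgetPex _ _ (is_multiplier mu m Lambda Theta)).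
  by exists M'; exact: is_multiplierP.
split=> // f g; rewrite /rdot (MP.2 f g).2 /=; apply: eq_Rintegral => w _.
by rewrite /multiplier_integrand /mform /rdot linearZl_LR.
Qed.

End MultiplierExistence.

(** * Multipliers of a perturbed continuous g-frame *)

Section GFramePerturbation.
Set Implicit Arguments.
Unset Strict Implicit.
Unset Printing Implicit Defensive.
Local Open Scope complex_scope.
Context {R : realType} {d : measure_display} {Omega : measurableType d}.
Variable mu : {measure set Omega -> \bar R}.

Lemma cesssup_ge0 (F : Omega -> R[i]) : (0 <= cesssup mu F)%E.
Proof. exact: Lnorm_ge0. Qed.

(** When [mu] vanishes the norm is [0] by convention, and the claim holds since
  every property then holds almost everywhere. *)
Lemma cesssup_ae (F : Omega -> R[i]) (l : R) : (cesssup mu F <= l%:E)%E ->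
  {ae mu, forall w, complex.Re `|F w| <= l}.
Proof.
rewrite /cesssup unlock; case: ifPn => [_ /ess_supP|mu0 _].
  apply: filterS => w /=; rewrite lee_fin; exact: le_trans (ler_norm _).
exists [set: Omega]; split=> //; apply/eqP.
by rewrite eq_le measure_ge0 andbT leNgt.
Qed.

Context {H : hilbertType R} {K : Omega -> hilbertType R}.
Variables (Lambda Theta : forall w : Omega, H -> K w).
Variables (A B nu lambda : R) (m : Omega -> R[i]).
Hypotheses (lLambda : forall w, linear (Lambda w))
  (lTheta : forall w, linear (Theta w)).
Hypothesis frameLambda : cgframe mu Lambda A B.
Hypothesis measTheta : forall f, strongly_measurable (fun w => Theta w f).
Hypotheses (nu_ge0 : 0 <= nu).
Hypothesis close : forall f : H,
  (\int[mu]_w (rnorm ((Lambda w \- Theta w) f) ^+ 2)%:E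
     <= (nu * rnorm f ^+ 2)%:E)%E.
Hypothesis m_near1 : (cesssup mu (fun w => m w - 1)%R <= lambda%:E)%E.

Let Psi w : H -> K w := Lambda w \- Theta w.

Local Notation form m T f g :=
  (mform m (fun w => T w f) (fun w => Lambda w g)).
Local Notation M := (multiplier mu m Lambda Theta).
Local Notation M0 := (multiplier mu m Lambda Lambda).
Local Notation s := (Num.sqrt (nu * B)).

Let B_gt0 : 0 < B.
Proof. by have [_ /andP[A0 AB] _] := frameLambda; exact: lt_le_trans AB. Qed.
Let dLambda f : support_discrete (fun w => Lambda w f).
Proof. by apply: strongly_measurable_discrete; have [] := frameLambda. Qed.
Let dPsi f : support_discrete (fun w => Psi w f).
Proof.
by apply: support_discrete_sub => //; exact: strongly_measurable_discrete.
Qed.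

Let Lambda_le f :
  (\int[mu]_w (rnorm (Lambda w f) ^+ 2)%:E <= ((Num.sqrt B * rnorm f) ^+ 2)%:E)%E.
Proof.
have [_ _ /(_ f) /andP[_]] := frameLambda.
by rewrite exprMn sqr_sqrtr// ltW.
Qed.

Let Psi_le f :
  (\int[mu]_w (rnorm (Psi w f) ^+ 2)%:E <= ((Num.sqrt nu * rnorm f) ^+ 2)%:E)%E.
Proof. by rewrite exprMn sqr_sqrtr//; exact: close. Qed.

Lemma lambda_ge0 : 0 <= lambda.
Proof. by rewrite -lee_fin (le_trans _ m_near1)// cesssup_ge0. Qed.

Let lambda1_ge0 : 0 <= lambda + 1. Proof. by rewrite addr_ge0// lambda_ge0. Qed.

Let m_le : {ae mu, forall w, complex.Re `|m w| <= lambda + 1}.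
Proof.
apply: filterS (cesssup_ae m_near1) => w mw.
rewrite -lecR RRe_real ?normr_real// -[m w](subrK 1).
rewrite (le_trans (ler_normD _ _))// normr1 rmorphD rmorph1 lerD2r.
by rewrite -[leLHS]RRe_real ?normr_real// lecR.
Qed.

Let one_sub_m_le : {ae mu, forall w, complex.Re `|1 - m w| <= lambda}.
Proof. by apply: filterS (cesssup_ae m_near1) => w; rewrite distrC. Qed.

Let sqrtB_ge0 (f : H) : 0 <= Num.sqrt B * rnorm f.
Proof. by rewrite mulr_ge0 ?sqrtr_ge0 ?rnorm_ge0. Qed.
Let sqrtnu_ge0 (f : H) : 0 <= Num.sqrt nu * rnorm f.
Proof. by rewrite mulr_ge0 ?sqrtr_ge0 ?rnorm_ge0. Qed.

Lemma form_Lambda f g :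
  mu.-integrable [set: Omega] (EFin \o form m Lambda f g) /\
  \int[mu]_w form m Lambda f g w <= (lambda + 1) * B * rnorm f * rnorm g.
Proof.
split; first exact: (mform_integrable m_le (a := Num.sqrt B * rnorm f)
  (b := Num.sqrt B * rnorm g)).
apply: (le_trans
  (mform_integral_le m_le _ _ _ _ _ (Lambda_le f) (Lambda_le g))) => //.
have -> : (lambda + 1) * B = (lambda + 1) * Num.sqrt B ^+ 2.
  by rewrite sqr_sqrtr// ltW.
by rewrite le_eqVlt; apply/orP; left; apply/eqP; ring.
Qed.

Lemma form_Psi f g :
  mu.-integrable [set: Omega] (EFin \o form m Psi f g) /\
  \int[mu]_w form m Psi f g w <= (lambda + 1) * s * rnorm f * rnorm g.
Proof.
split; first exact: (mform_integrable m_le (a := Num.sqrt nu * rnorm f)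
  (b := Num.sqrt B * rnorm g)).
apply: le_trans (mform_integral_le m_le _ _ _ _ _ (Psi_le f) (Lambda_le g)) _ => //.
rewrite sqrtrM//.
by rewrite le_eqVlt; apply/orP; left; apply/eqP; ring.
Qed.

(** Subtracting forms avoids estimating [\int |Theta f|^2]: [Theta] enters only
  through [Psi], the distance to [Lambda]. *)
Lemma form_Theta f g :
  mu.-integrable [set: Omega] (EFin \o form m Theta f g) /\
  \int[mu]_w form m Theta f g w =
    \int[mu]_w form m Lambda f g w - \int[mu]_w form m Psi f g w.
Proof.
have [iL _] := form_Lambda f g; have [iP _] := form_Psi f g.
have E w : form m Theta f g w = form m Lambda f g w - form m Psi f g w.
  by rewrite /mform -rdotBl -scalerBr /Psi /= subKr.
split; last by rewrite -RintegralB//; apply: eq_Rintegral => w _; exact: E.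
have := integrableB measurableT iL iP.
by apply: eq_integrable => // w _ /=; rewrite E.
Qed.

Lemma form_Theta_le f g : \int[mu]_w form m Theta f g w <=
  (lambda + 1) * (B + s) * rnorm f * rnorm g.
Proof.
have [_ ->] := form_Theta f g; have [_ leL] := form_Lambda f g.
have [_] := form_Psi (- f) g; rewrite rnormN.
have [iP _] := form_Psi f g.
have -> : \int[mu]_w form m Psi (- f) g w = - \int[mu]_w form m Psi f g w.
  rewrite -mulN1r -RintegralZl//; apply: eq_Rintegral => w _.
  rewrite /mform; have -> : Psi w (- f) = - Psi w f.
    rewrite /Psi /= -scaleN1r (linear_scale (lLambda w)).
    by rewrite (linear_scale (lTheta w)) !scaleN1r opprD.
  by rewrite scalerN rdotNl mulN1r.
by move: leL; lra.
Qed.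

Lemma multiplier_Lambda : is_multiplier mu m Lambda Lambda M0 /\
  forall f g, rdot (M0 f) g = \int[mu]_w form m Lambda f g w.
Proof.
apply: (@multiplier_spec _ _ _ _ _ _ _ _ _ ((lambda + 1) * B)) => //.
- by move=> f g; exact: (form_Lambda f g).1.
- by rewrite mulr_ge0// ltW.
- by move=> f g; exact: (form_Lambda f g).2.
Qed.

Let bound_ge0 : 0 <= (lambda + 1) * (B + s).
Proof. by rewrite mulr_ge0// addr_ge0 ?sqrtr_ge0// ltW. Qed.

Lemma multiplier_Theta : is_multiplier mu m Lambda Theta M /\
  forall f g, rdot (M f) g = \int[mu]_w form m Theta f g w.
Proof.
apply: (@multiplier_spec _ _ _ _ _ _ _ _ _ ((lambda + 1) * (B + s))) => //.
- by move=> f g; exact: (form_Theta f g).1.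
- exact: form_Theta_le.
Qed.

Lemma multiplier_Theta_le f : rnorm (M f) <= (lambda + 1) * (B + s) * rnorm f.
Proof.
apply: rnorm_dual => [|g]; first by rewrite mulr_ge0// rnorm_ge0.
by rewrite multiplier_Theta.2 form_Theta_le.
Qed.

Lemma multiplier_diff_le f :
  rnorm (M0 f - M f) <= (lambda + 1) * s * rnorm f.
Proof.
apply: rnorm_dual => [|g]; first by rewrite !mulr_ge0 ?sqrtr_ge0// rnorm_ge0.
rewrite rdotBl multiplier_Lambda.2 multiplier_Theta.2 (form_Theta f g).2 subKr.
exact: (form_Psi f g).2.
Qed.

(** [|Lambda f|^2] splits as [m |Lambda f|^2 + (1 - m) |Lambda f|^2]; the frame
  inequality bounds the integral of the sum from below, the estimate for the
  weight [1 - m] bounds the second term from above. *)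
Lemma multiplier_Lambda_coercive : coercive (A - lambda * B) M0.
Proof.
move=> f; rewrite multiplier_Lambda.2.
have iD := mform_integrable one_sub_m_le (@dLambda f) (@dLambda f)
  (Lambda_le f) (Lambda_le f).
have leD := mform_integral_le one_sub_m_le (@dLambda f) (@dLambda f)
  lambda_ge0 (sqrtB_ge0 f) (sqrtB_ge0 f) (Lambda_le f) (Lambda_le f).
have [iL _] := form_Lambda f f.
have E w : rnorm (Lambda w f) ^+ 2 =
    form m Lambda f f w + form (fun w => 1 - m w) Lambda f f w.
  by rewrite /mform -rdotDl -scalerDl addrC subrK scale1r rdot_norm.
have : A * rnorm f ^+ 2 <= \int[mu]_w form m Lambda f f w +
    \int[mu]_w form (fun w => 1 - m w) Lambda f f w.
  rewrite -RintegralD// -lee_fin /Rintegral fineK; last first.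
    apply: integrable_fin_num => //.
    by apply: eq_integrable (integrableD measurableT iL iD).
  under eq_integral do rewrite -E.
  by have [_ _ /(_ f) /andP[]] := frameLambda.
have -> : (A - lambda * B) * rnorm f ^+ 2 =
  A * rnorm f ^+ 2 - lambda * (Num.sqrt B * rnorm f) * (Num.sqrt B * rnorm f).
  by rewrite -{1}(sqr_sqrtr (ltW B_gt0)); ring.
by move: leD; lra.
Qed.

Hypothesis lambda_lt : lambda < (A - s) / (B + s).

(** The bound on [lambda], cleared of its denominator. *)
Lemma gap_gt0 : (lambda + 1) * s < A - lambda * B.
Proof.
move: lambda_lt; rewrite ltr_pdivlMr; last by rewrite ltr_pwDl ?sqrtr_ge0.
by lra.
Qed.

End GFramePerturbation.

Theorem theorem2p6 (R : realType) (d : measure_display)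
  (Omega : measurableType d) (mu : {measure set Omega -> \bar R})
  (H : hilbertType R) (K : Omega -> hilbertType R)
  (Lambda Theta : forall w : Omega, H -> K w)
  (A B nu lambda : R) (m : Omega -> R[i])
  (bLambda : forall w, bounded_operator (Lambda w))
  (bTheta : forall w, bounded_operator (Theta w))
  (frameLambda : cgframe mu Lambda A B)
  (measTheta : forall f : H, strongly_measurable (fun w => Theta w f))
  (nu_ge0 : 0 <= nu) (nu_lt : nu < A ^+ 2 / B)
  (close : forall f : H,
    (\int[mu]_w (rnorm ((Lambda w \- Theta w) f) ^+ 2)%:E
       <= (nu * rnorm f ^+ 2)%:E)%E)
  (mLinfty : cLinfty mu m)
  (m_near1 : (cesssup mu (fun w => m w - 1)%R <= lambda%:E)%E)
  (lambda_lt :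
    lambda < (A - Num.sqrt (nu * B)) / (B + Num.sqrt (nu * B))) :
  let M := multiplier mu m Lambda Theta in
  let M0 := multiplier mu m Lambda Lambda in
  let partial_sum (n : nat) : H -> H :=
    fun f => \sum_(0 <= k < n) iter k (opinv M0 \o (M0 \- M)) (opinv M0 f) in
  (is_multiplier mu m Lambda Theta M /\ is_multiplier mu m Lambda Lambda M0) /\
  (GL M /\ GL M0) /\
  (forall f : H,
    1 / ((lambda + 1) * (B + Num.sqrt (nu * B))) * rnorm f
      <= rnorm (opinv M f)
      <= 1 / (A - lambda * B - (lambda + 1) * Num.sqrt (nu * B)) * rnorm f) /\
  (fun n => opnorm (opinv M \- partial_sum n)%R) @ \oo --> 0%E /\
  (forall n : nat,
    (opnorm (opinv M \- partial_sum n.+1)%R <=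
      (((lambda + 1) * Num.sqrt (nu * B) / (A - lambda * B)) ^+ n.+1
        * (1 / (A - lambda * B - (lambda + 1) * Num.sqrt (nu * B))))%:E)%E).
Proof.
have lL w : linear (Lambda w) by have [] := bLambda w.
have lT w : linear (Theta w) by have [] := bTheta w.
move=> M M0 partial_sum.
have [mM _] := multiplier_Theta lL lT frameLambda measTheta nu_ge0 close m_near1.
have [mM0 _] := multiplier_Lambda lL frameLambda m_near1.
have M_le := multiplier_Theta_le lL lT frameLambda measTheta nu_ge0 close m_near1.
have cM0 := multiplier_Lambda_coercive lL frameLambda m_near1.
have M0M := multiplier_diff_le lL lT frameLambda measTheta nu_ge0 close m_near1.
have gap := gap_gt0 frameLambda lambda_lt.
have l0 := lambda_ge0 m_near1.
have B0 : 0 < B by have [_ /andP[A0 AB] _] := frameLambda; exact: lt_le_trans AB.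
have delta0 : 0 <= (lambda + 1) * Num.sqrt (nu * B).
  by rewrite mulr_ge0 ?sqrtr_ge0// addr_ge0.
have c0 : 0 < A - lambda * B by exact: le_lt_trans gap.
have cd0 : 0 < A - lambda * B - (lambda + 1) * Num.sqrt (nu * B).
  by rewrite subr_gt0.
have cM := coercive_perturbation cM0 M0M.
have [bM _] := mM; have [bM0 _] := mM0.
split; first by [].
split; first by split; [exact: coercive_GL cM|exact: coercive_GL cM0].
split.
  move=> f; apply/andP; split; last exact: rnorm_opinv_le.
  have N0 : 0 < (lambda + 1) * (B + Num.sqrt (nu * B)).
    by apply: mulr_gt0; [exact: ltr_pwDr|rewrite ltr_pwDl ?sqrtr_ge0].
  have := M_le (opinv M f); rewrite (coercive_opinv cd0 bM cM).2.
  by rewrite div1r ler_pdivrMl.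
split; first exact: (opnorm_neumann_remainder_cvg bM bM0 delta0 gap cM0 M0M).
by move=> n; exact: (opnorm_neumann_remainder_le bM bM0 delta0 gap cM0 M0M).
Qed.
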